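(* Let $\mu\subseteq\lambda$ be partitions, $\lambda=(\lambda_1,\dots,\lambda_\ell)$ and $\mu=(\mu_1,\dots,\mu_\ell)$ (with trailing zeros allowed), and let $\mathbf{x}=(x_1,\dots,x_n)$ and $\mathbf{t}=(t_1,\dots,t_\ell)$ be commuting indeterminates. The skew refined dual Grothendieck polynomials have the determinant formula $$g_{\lambda/\mu}(\mathbf{x};\mathbf{t})=\det\left[\sum_{m=0}^{\infty}\alpha_m^{ij}(\mathbf{t})\,h_{\lambda_i-\mu_j-i+j-m}(\mathbf{x})\right]_{i,j=1}^{\ell},$$ where $\alpha_m^{ij}(\mathbf{t})=h_m(t_j,\dots,t_{i-1})$ for $i\ge j$ and $\alpha_m^{ij}(\mathbf{t})=e_m(-t_i,\dots,-t_{j-1})$ for $i<j$.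
   Context: $h_k$ and $e_k$ are the complete homogeneous and elementary symmetric polynomials, with $h_0=e_0=1$, $h_k=e_k=0$ for $k<0$, and $h_m$ of the empty set of variables (the case $i=j$) equal to $\delta_{m0}$. A reverse plane partition of skew shape $\lambda/\mu$ (English convention, row 1 at the top) is a filling of the boxes of $\lambda/\mu$ with positive integers that weakly increases along rows and down columns. Let $\mathrm{RPP}^n(\lambda/\mu)$ be the set of those with all entries at most $n$. For such $T$, let $a_i$ be the number of columns of $T$ containing $i$, and let $b_r$ be the number of boxes in row $r$ for which the box directly below lies in $\lambda/\mu$ and has the same entry. The skew refined dual Grothendieck polynomial is $g_{\lambda/\mu}(\mathbf{x};\mathbf{t})=\sum_{T\in\mathrm{RPP}^n(\lambda/\mu)}\prod_r t_r^{b_r}\prod_i x_i^{a_i}$. *)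

(* Defs.v *)
From mathcomp Require Import all_boot all_order all_algebra.
From mathcomp Require Import classical_sets cardinality fsbigop.
From mathcomp Require Import mpoly.
From mathcomp Require Import zify.

Set Implicit Arguments.
Unset Strict Implicit.
Unset Printing Implicit Defensive.

Import GRing.Theory.

Local Open Scope ring_scope.

Definition mcomplete (n : nat) (A : comNzRingType) (d : nat) : {mpoly A[n]} :=
  \sum_(m : 'X_{1..n < d.+1} | mdeg m == d) 'X_[m].

(* h_k and e_m at a finite list of ring elements *)
Definition hsym (A : comNzRingType) (s : seq A) (k : int) : A :=
  match k with
  | Posz d => (mcomplete (size s) A d).@[fun i => nth 0 s i]
  | Negz _ => 0
  end.

Definition esym (A : comNzRingType) (s : seq A) (m : nat) : A :=
  (mesym (size s) A m).@[fun i => nth 0 s i].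

Section SkewShape.
Variables (l : nat) (lam mu : l.-tuple nat).

(* Rows, columns and entries are numbered from 0. *)
Definition in_skew (c : 'I_l * 'I_(head 0%N lam)) : bool :=
  (tnth mu c.1 <= c.2 < tnth lam c.1)%N.

Definition box := {c : 'I_l * 'I_(head 0%N lam) | in_skew c}.

Definition brow (c : box) : 'I_l := (val c).1.
Definition bcol (c : box) : 'I_(head 0%N lam) := (val c).2.

Definition is_rpp (n : nat) (T : {ffun box -> 'I_n}) : bool :=
  [forall c : box, forall d : box,
     [&& brow c == brow d & (bcol c <= bcol d)%N] ==> (T c <= T d)%N] &&
  [forall c : box, forall d : box,
     [&& bcol c == bcol d & (brow c <= brow d)%N] ==> (T c <= T d)%N].

Definition rpp_cols (n : nat) (T : {ffun box -> 'I_n}) (i : 'I_n) : nat :=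
  #|[pred j : 'I_(head 0%N lam) |
      [exists c : box, (bcol c == j) && (T c == i)]]|.

Definition rpp_dups (n : nat) (T : {ffun box -> 'I_n}) (r : 'I_l) : nat :=
  #|[pred c : box | (brow c == r) &&
      [exists d : box, [&& brow d == (brow c).+1 :> nat, bcol d == bcol c
                         & T d == T c]]]|.

End SkewShape.

Section Polynomials.
Variables (R : comNzRingType) (n l : nat).

(* x_1, ..., x_n and t_1, ..., t_l are the n + l variables of one polynomial
   ring *)
Definition xvar (i : 'I_n) : {mpoly R[n + l]} := 'X_(lshift l i).
Definition tvar (r : 'I_l) : {mpoly R[n + l]} := 'X_(rshift n r).

Definition xvars : seq {mpoly R[n + l]} := [seq xvar i | i <- enum 'I_n].

(* the list of variables t_r with a <= r < b, where r is counted from 0 *)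
Definition tvars (a b : nat) : seq {mpoly R[n + l]} :=
  [seq tvar r | r : 'I_l <- enum 'I_l & (a <= r < b)%N].

Definition skew_dual_groth (lam mu : l.-tuple nat) : {mpoly R[n + l]} :=
  \sum_(T : {ffun box lam mu -> 'I_n} | is_rpp T)
    (\prod_(r < l) tvar r ^+ rpp_dups T r) *
    (\prod_(i < n) xvar i ^+ rpp_cols T i).

Definition jt_alpha (i j : 'I_l) (m : nat) : {mpoly R[n + l]} :=
  if (j <= i)%N then hsym (tvars j i) m%:Z
  else esym [seq - t | t <- tvars i j] m.

(* Only finitely many terms are nonzero, so summing over all m with \sum_(m \in
   [set: nat]) never falls back on the default value 0 of that operator. *)
Lemma jt_finite_support (lam mu : l.-tuple nat) (i j : 'I_l) :
  finite_set (setI [set: nat]%classic (preimage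
    (fun m : nat => jt_alpha i j m *
       hsym xvars ((tnth lam i)%:Z - (tnth mu j)%:Z - i%:Z + j%:Z - m%:Z))
    (setC [set 0]%classic))).
Proof.
apply: (@sub_finite_set _ _ (classical_sets.mkset
  (fun k => k < (tnth lam i + j).+1)%N)); last exact: finite_II.
move=> m [_] /= nz; rewrite ltnS leqNgt; apply/negP => ltm; apply: nz.
suff [d ->] : exists d, (tnth lam i)%:Z - (tnth mu j)%:Z - i%:Z + j%:Z - m%:Z
  = Negz d by rewrite /= mulr0.
exists (m - (tnth lam i + j) + tnth mu j + i).-1%N.
rewrite NegzE; lia.
Qed.

End Polynomials.

(* Main.v *)
Require Import Defs.
From mathcomp Require Import all_boot all_order all_algebra.
From mathcomp Require Import classical_sets cardinality fsbigop.
From mathcomp Require Import perm mpoly.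
From mathcomp Require Import zify ring.

(* Both sides satisfy the same recursion in the number of x-variables.  Cutting
   a reverse plane partition at its largest entry writes the left-hand side as
   the sum over partitions nu between mu and lam of that of nu/mu times
     prod_i x^(lam_i - max(nu_i, lam_(i+1))) * t_i^(lam_(i+1) - nu_i),
   where x is the last variable.  On the other side, entry (i, j) is the value
   at p = lam_i - i of a sequence v_i depending on j, with generating series
   V_i(z) for the alphabet including x and v_i(z) for the alphabet without x
   satisfying V_i = v_i / (1 - x z) and v_(i+1) = v_i / (1 - t_i z).
   Subtracting a multiple of row i+1 from row i turns the expansion of row i into
   the one with the above weights as coefficients; expanding the determinant
   multilinearly, the terms with rows out of order sum to multiples of the next
   row, so they cancel and only partitions nu survive.  Without x-variables the
   matrix is unitriangular if lam = mu and has a large zero block otherwise. *)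

Set Implicit Arguments.
Unset Strict Implicit.
Unset Printing Implicit Defensive.

Import GRing.Theory.

Local Open Scope ring_scope.

(** * Complete and elementary symmetric functions *)

Lemma esym_coef (A : comNzRingType) (s : seq A) (m : nat) :
  Defs.esym s m = (\prod_(a <- s) (a *: 'X + 1))`_m.
Proof.
rewrite (big_nth 0) big_mkord bigA_distr coef_sum /Defs.esym /mesym raddf_sum /=.
rewrite big_mkcond /=; apply: eq_bigr => J _.
rewrite rmorph_prod /= (eq_bigr (fun i : 'I_ _ => nth 0 s i)); last first.
  by move=> i _; rewrite mevalXU.
rewrite -big_mkcond /= scaler_prod prodr_const coefZ coefXn.
by rewrite eq_sym; case: eqP => _; rewrite ?mulr1 ?mulr0.
Qed.

Lemma esym0 (A : comNzRingType) (s : seq A) : Defs.esym s 0 = 1.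
Proof. by rewrite /Defs.esym mesym0E rmorph1. Qed.

Lemma esym_oversize (A : comNzRingType) (s : seq A) m :
  (size s < m)%N -> Defs.esym s m = 0.
Proof. by move=> sm; rewrite /Defs.esym mesym_geqnE // rmorph0. Qed.

Lemma esym_consS (A : comNzRingType) (a : A) (s : seq A) m :
  Defs.esym (a :: s) m.+1 = Defs.esym s m.+1 + a * Defs.esym s m.
Proof.
by rewrite !esym_coef big_cons mulrDl mul1r coefD -scalerAl coefZ coefXM addrC.
Qed.

(* Only the coefficients of degree at most d of the geometric series matter. *)
Lemma hsym_coef (A : comNzRingType) (s : seq A) (d D : nat) : (d <= D)%N ->
  hsym s d = (\prod_(a <- s) \poly_(k < D.+1) a ^+ k)`_d.
Proof.
move=> dD; rewrite (big_nth 0) big_mkord /=.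
under [in RHS]eq_bigr do rewrite poly_def.
rewrite bigA_distr_bigA coef_sum /mcomplete raddf_sum /=.
under [in RHS]eq_bigr => f _ do
  rewrite scaler_prod prodrXr coefZ coefXn.
rewrite [RHS](bigID (fun f : {ffun 'I_(size s) -> 'I_D.+1} =>
   (\sum_i f i)%N == d)) /= [X in _ + X]big1 ?addr0; last first.
  by move=> f /negPf nd; rewrite eq_sym nd mulr0.
pose tof (m : 'X_{1..(size s) < d.+1}) : {ffun 'I_(size s) -> 'I_D.+1} :=
  [ffun i => inord (m i)].
pose ofm (f : {ffun 'I_(size s) -> 'I_D.+1}) : 'X_{1..(size s) < d.+1} :=
  insubd bm0 [multinom (f i : nat) | i < size s].
have ofmE (f : {ffun 'I_(size s) -> 'I_D.+1}) :
    (\sum_i f i)%N == d -> ofm f =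
      [multinom (f i : nat) | i < size s] :> 'X_{1..(size s)}.
  move=> /eqP fd; rewrite /ofm val_insubd mdegE.
  by under eq_bigr do rewrite mnmE; rewrite fd ltnSn.
have le_m (m : 'X_{1..(size s) < d.+1}) i : (m i < D.+1)%N.
  have := bmdeg m; rewrite mdegE (bigD1 i) //=; lia.
rewrite (reindex_onto tof ofm); last first.
  move=> f fd; apply/ffunP => i; rewrite ffunE ofmE // mnmE.
  by apply: val_inj; rewrite /= inordK.
have tofE m i : tof m i = m i :> nat by rewrite ffunE inordK.
apply: eq_big => [m|m md].
  under eq_bigr do rewrite tofE.
  rewrite -mdegE; case: eqP => //= md.
  apply/esym/eqP/val_inj => /=; apply/mnmP => i; rewrite ofmE ?mnmE ?tofE //.
  by apply/eqP; rewrite -[RHS]md mdegE; apply: eq_bigr => j _; rewrite tofE.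
rewrite mevalX; under [in RHS]eq_bigr do rewrite tofE.
suff -> : (\sum_i tof m i)%N = d by rewrite eqxx mulr1.
by rewrite -(eqP md) mdegE; apply: eq_bigr => i _; rewrite tofE.
Qed.

Lemma hsym_nil (A : comNzRingType) (d : nat) :
  hsym ([::] : seq A) d = (d == 0)%N%:R.
Proof. by rewrite (hsym_coef _ (leqnn d)) big_nil coef1. Qed.

Lemma hsym0 (A : comNzRingType) (s : seq A) : hsym s 0%N = 1.
Proof.
rewrite (hsym_coef _ (leqnn 0)) big1 ?coef1 // => a _.
by rewrite poly_def big_ord1 scale1r.
Qed.

Lemma hsym_rconsS (A : comNzRingType) (s : seq A) a (d : nat) :
  hsym (rcons s a) d.+1 = hsym s d.+1 + a * hsym (rcons s a) d.
Proof.
rewrite !(hsym_coef _ (leqnn d.+1)) (hsym_coef _ (leqnSn d)) !big_rcons /=.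
set P := \prod_(b <- s) _; rewrite !coefMr big_ord_recl subn0.
rewrite coef_poly expr0 mulr1; congr (_ + _); rewrite mulr_sumr.
apply: eq_bigr => k _ /=; rewrite /bump add1n subSS !coef_poly ltnS.
have [lk ld] : (k < d.+2)%N /\ (k < d.+1)%N by case: k => k /=; lia.
by rewrite lk ld exprS; ring.
Qed.

(** * Adding one variable to the determinant *)

(* In terms of generating series, W'(z) = W(z) / (1 - x z). *)
Definition geometric (A : comNzRingType) (x : A) (w w' : nat -> A) :=
  w' 0%N = w 0%N /\ forall d, w' d.+1 = w d.+1 + x * w' d.

Lemma geometric_sum (A : comNzRingType) (x : A) w w' d : geometric x w w' ->
  w' d = \sum_(0 <= s < d.+1) x ^+ (d - s) * w s.
Proof.
case=> w0 wS; elim: d => [|d IH]; first by rewrite big_nat1 mul1r.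
rewrite wS IH [RHS]big_nat_recr //= subnn mul1r [LHS]addrC mulr_sumr; congr (_ + _).
by apply: eq_big_nat => s sd; rewrite subSn; [rewrite exprS mulrA | lia].
Qed.

Lemma geometric_exchange (A : comNzRingType) (x t : A) v v' V V' d :
    geometric t v v' -> geometric x v V -> geometric x v' V' ->
  t * v' d = x * V d - (x - t) * V' d.
Proof.
move=> [a0 aS] [b0 bS] [c0 cS].
suff : t * v' d + x * V' d = x * V d + t * V' d.
  by move=> /(congr1 (fun y => y - x * V' d)); rewrite addrK => ->; ring.
elim: d => [|d IH]; first by rewrite c0 a0 b0; ring.
have e : V' d.+1 = V d.+1 + t * V' d.
  by rewrite cS aS -addrA IH bS addrA.
rewrite {1}e cS; ring.
Qed.

(* The truncated subtractions make this one formula for the two cases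
   s <= b and b < s. *)
Lemma row_reduction (A : comNzRingType) (x t : A) v v' V V' a b :
    geometric t v v' -> geometric x v V -> geometric x v' V' -> (b < a)%N ->
  \sum_(0 <= s < a.+1) x ^+ (a - maxn s b.+1) * t ^+ (b.+1 - s) * v s =
  V a - x ^+ (a - b.+1) * (x - t) * V' b.
Proof.
move=> gv gV gV' ba; rewrite (geometric_sum _ gV).
rewrite !(@big_cat_nat _ _ _ b.+1 0 a.+1) //=; try lia.
rewrite addrAC; congr (_ + _); last first.
  apply: eq_big_nat => s sb; have -> : (b.+1 - s = 0)%N by lia.
  by rewrite mulr1; have -> : maxn s b.+1 = s by lia.
transitivity (x ^+ (a - b.+1) * (t * v' b)).
  rewrite (geometric_sum _ gv) !mulr_sumr; apply: eq_big_nat => s sb.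
  have -> : maxn s b.+1 = b.+1 by lia.
  by rewrite subSn; [rewrite exprS !mulrA | lia].
rewrite (geometric_exchange b gv gV gV') mulrBr mulrA.
congr (_ - _); last by rewrite mulrA.
rewrite (geometric_sum _ gV) mulr_sumr; apply: eq_big_nat => s sb.
by rewrite -exprSr mulrA -exprD; congr (x ^+ _ * _); lia.
Qed.

Lemma det_sum_rows (A : comNzRingType) l K (c : 'I_l -> 'I_K -> A)
    (v : 'I_l -> 'I_K -> 'I_l -> A) :
  \det (\matrix_(i, j) \sum_s c i s * v i s j) =
  \sum_(f : {ffun 'I_l -> 'I_K})
    (\prod_i c i (f i)) * \det (\matrix_(i, j) v i (f i) j).
Proof.
under [RHS]eq_bigr do rewrite /determinant mulr_sumr.
rewrite exchange_big /=; apply: eq_bigr => s _.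
under eq_bigr do rewrite mxE.
rewrite bigA_distr_bigA mulr_sumr; apply: eq_bigr => f _.
rewrite big_split mulrCA /=; congr (_ * (_ * _)).
by apply: eq_bigr => i _; rewrite mxE.
Qed.

Definition update l K (f : {ffun 'I_l -> 'I_K}) (k : 'I_l) (s : 'I_K) :
  {ffun 'I_l -> 'I_K} := [ffun i => if i == k then s else f i].

Lemma sum_update0 (A : comNzRingType) l K (k : 'I_l)
    (P : pred {ffun 'I_l -> 'I_K.+1}) (F : {ffun 'I_l -> 'I_K.+1} -> A) :
    (forall f, \sum_(s | P (update f k s)) F (update f k s) = 0) ->
  \sum_(f | P f) F f = 0.
Proof.
move=> H; rewrite (partition_big (fun f => update f k ord0) xpredT) //=.
apply: big1 => g _.
have [gk|gk] := eqVneq (g k) ord0; last first.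
  apply: big_pred0 => f; apply/negP => /andP[_ /eqP fg].
  by move: gk; rewrite -fg ffunE eqxx.
rewrite (reindex_onto (update g k) (fun f => f k)) /=; last first.
  move=> f /andP[_ /eqP <-]; apply/ffunP => i; rewrite !ffunE.
  by case: eqP => [->|].
rewrite -[RHS](H g); apply: eq_bigl => s.
have -> : update (update g k s) k ord0 = g.
  by apply/ffunP => i; rewrite !ffunE; case: eqP => [->|].
by rewrite !ffunE !eqxx !andbT.
Qed.

Lemma det_row_sum0 (A : comNzRingType) l K (k k' : 'I_l) (P : pred 'I_K)
    (c : 'I_K -> A) (gam : A) (M : 'I_K -> 'M[A]_l) :
    k != k' ->
    (forall s i j, i != k -> forall s', M s i j = M s' i j) ->
    (forall j s', \sum_(s | P s) c s * M s k j = gam * M s' k' j) ->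
  \sum_(s | P s) c s * \det (M s) = 0.
Proof.
move=> kk' Mk Mg.
have [s0 Ps0|P0] := pickP P; last by rewrite big_pred0.
transitivity (\sum_j (\sum_(s | P s) c s * M s k j) * cofactor (M s0) k j).
  under eq_bigr do rewrite (expand_det_row _ k) mulr_sumr.
  rewrite exchange_big /=; apply: eq_bigr => j _; rewrite mulr_suml.
  apply: eq_bigr => s _; rewrite mulrA; congr (_ * (_ * \det _)).
  by apply/matrixP => i j'; rewrite !mxE; apply: Mk; rewrite eq_sym neq_lift.
pose N := \matrix_(i, j) M s0 (if i == k then k' else i) j.
transitivity (gam * \det N); last first.
  rewrite (determinant_alternate kk') ?mulr0 // => j.
  by rewrite !mxE eqxx eq_sym (negPf kk').
rewrite (expand_det_row _ k) mulr_sumr; apply: eq_bigr => j _.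
rewrite (Mg j s0) mxE eqxx -mulrA; congr (_ * (_ * (_ * \det _))).
by apply/matrixP => i j'; rewrite !mxE eq_sym (negPf (neq_lift _ _)).
Qed.

Section OneVariable.
Variables (A : comNzRingType) (l K : nat) (x : A) (t : nat -> A).
Variables (v V : nat -> nat -> 'I_l -> A) (p : nat -> nat).
Hypothesis v_geom : forall i j, geometric (t i) (v i ^~ j) (v i.+1 ^~ j).
Hypothesis V_geom : forall i j, geometric x (v i ^~ j) (V i ^~ j).
Hypothesis v0 : forall i j, v i 0%N j = 0.
Hypothesis p_dec : forall i, (i < l)%N -> (p i.+1 < p i)%N.
Hypothesis p_end : p l = 0%N.
Hypothesis p_lt : forall i, (p i < K.+1)%N.

Definition row_coef (i s : nat) : A :=
  if (s <= p i)%N then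
    x ^+ (p i - maxn s (p i.+1).+1) * t i ^+ ((p i.+1).+1 - s)
  else 0.

Let term (f : {ffun 'I_l -> 'I_K.+1}) : A :=
  (\prod_(i < l) row_coef i (f i)) * \det (\matrix_(i, j) v i (f i) j).

Lemma det_expand_rows :
  \det (\matrix_(i < l, j < l) V i (p i) j) = \sum_f term f.
Proof.
pose L := \matrix_(i < l, k < l) ((k == i)%:R -
  (k == i.+1 :> nat)%:R * (x ^+ (p i - (p i.+1).+1) * (x - t i))) : 'M[A]_l.
rewrite -(det_sum_rows (fun i s => row_coef i s) (fun i s j => v i s j)).
have detL : \det L = 1.
  rewrite -det_tr det_trig; last first.
    apply/is_trig_mxP => i j ij; rewrite !mxE.
    have -> : (i == j) = false by apply/eqP => /(congr1 val) /=; lia.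
    by have -> : (i == j.+1 :> nat) = false; [apply/eqP; lia | rewrite mul0r subrr].
  apply: big1 => i _; rewrite !mxE eqxx.
  by have -> : (i == i.+1 :> nat) = false; [apply/eqP; lia | rewrite mul0r subr0].
rewrite -[LHS]mul1r -detL -det_mulmx; congr (\det _); apply/matrixP => i j.
rewrite !mxE; transitivity
  (V i (p i) j - x ^+ (p i - (p i.+1).+1) * (x - t i) * V i.+1 (p i.+1) j).
  under eq_bigr do rewrite !mxE mulrBl.
  rewrite sumrB (bigD1 i) //= eqxx mul1r big1 ?addr0; last first.
    by move=> k /negPf ki; rewrite ki mul0r.
  congr (_ - _); case: (ltnP i.+1 l) => il.
    rewrite (bigD1 (Ordinal il)) //= eqxx mul1r big1 ?addr0 // => k.
    by move=> /negPf; rewrite -val_eqE /= => ->; rewrite !mul0r.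
  have e : i.+1 = l by have := ltn_ord i; lia.
  rewrite big1; last first.
    move=> k _; have -> : (k == i.+1 :> nat) = false by have := ltn_ord k; lia.
    by rewrite !mul0r.
  by rewrite e p_end (V_geom l j).1 v0 mulr0.
rewrite -(row_reduction (v_geom i j) (V_geom i j) (V_geom i.+1 j)) ?p_dec //.
rewrite [LHS]big_mkord (big_ord_widen K.+1
  (fun s => x ^+ (p i - maxn s (p i.+1).+1) *
  t i ^+ ((p i.+1).+1 - s) * v i s j)) ?p_lt //.
rewrite big_mkcond; apply: eq_bigr => s _; rewrite /row_coef ltnS.
by case: ifP; rewrite ?mul0r.
Qed.

Lemma strict_sum0 (P : pred {ffun 'I_l -> 'I_K.+1}) (k k' : 'I_l) :
    (forall f s, P (update f k s) = P f) -> k' = k.+1 :> nat ->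
  \sum_(f | P f && (f k <= f k')%N) term f = 0.
Proof.
move=> Pk kk'; apply: (sum_update0 (k := k)) => f.
have k'k : (k' == k) = false by apply/eqP => /(congr1 val) /=; lia.
have fk' s : update f k s k' = f k' by rewrite ffunE k'k.
have fk s : update f k s k = s by rewrite ffunE eqxx.
rewrite (eq_bigl (fun s : 'I_K.+1 => P f && (s <= f k')%N)); last first.
  by move=> s; rewrite Pk fk' fk.
case: (P f); last by rewrite big_pred0.
case: (leqP (f k') (p k')) => fp; last first.
  apply: big1 => s _; rewrite /term (bigD1 k') //= fk' /row_coef.
  by rewrite leqNgt fp !mul0r.
pose G := \prod_(i : 'I_l | i != k) row_coef i (f i).
under eq_bigr => s _.
  rewrite /term (bigD1 k) //= fk (eq_bigr (fun i : 'I_l => row_coef i (f i))).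
    rewrite -/G mulrAC [_ * _ * G]mulrC.
    over.
  by move=> i /negPf ik; rewrite ffunE ik.
rewrite -mulr_sumr.
pose b := p k.+1; have pkk : (p k.+1 < p k)%N by exact: p_dec.
rewrite (det_row_sum0 (k := k) (k' := k')
  (gam := x ^+ (p k - b.+1) * t k ^+ (b.+1 - f k'))) ?mulr0 //.
- by rewrite eq_sym k'k.
- by move=> s i j /negPf ik s'; rewrite !mxE !ffunE ik.
move=> j s'; rewrite mxE fk' kk' (geometric_sum _ (v_geom k j)) mulr_sumr.
rewrite big_mkord [RHS](big_ord_widen K.+1
  (fun s => x ^+ (p k - b.+1) * t k ^+ (b.+1 - f k') *
  (t k ^+ (f k' - s) * v k s j))) //.
apply: eq_big => [s|s sf]; first by rewrite ltnS.
rewrite mxE fk /row_coef; rewrite kk' in fp.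
rewrite ifT; last by lia.
have -> : maxn s (p k.+1).+1 = b.+1 by rewrite /b; lia.
rewrite mulrA; congr (_ * _); rewrite -mulrA -exprD; congr (_ * _ ^+ _).
rewrite /b; lia.
Qed.

Definition strict_dec (f : {ffun 'I_l -> 'I_K.+1}) : bool :=
  [forall i : 'I_l, forall i' : 'I_l, (i' == i.+1 :> nat) ==> (f i' < f i)%N].

Lemma det_expand_strict :
  \det (\matrix_(i < l, j < l) V i (p i) j) = \sum_(f | strict_dec f) term f.
Proof.
pose Pk k (f : {ffun 'I_l -> 'I_K.+1}) := [forall i : 'I_l, forall i' : 'I_l,
  ((k <= i)%N && (i' == i.+1 :> nat)) ==> (f i' < f i)%N].
have PkP k (f : {ffun 'I_l -> 'I_K.+1}) : reflect
    (forall i i' : 'I_l, (k <= i)%N -> i' = i.+1 :> nat -> (f i' < f i)%N)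
    (Pk k f).
  apply: (iffP forallP) => [H i i' ki ii'|H i].
    by have /forallP/(_ i') := H i; rewrite ki ii' eqxx.
  by apply/forallP => i'; apply/implyP => /andP[? /eqP ?]; exact: H.
suff H k : (k <= l)%N -> \sum_f term f = \sum_(f | Pk (l - k)%N f) term f.
  rewrite det_expand_rows (H l) // subnn; apply: eq_bigl => f.
  by apply: eq_forallb => i.
elim: k => [|k IH] kl.
  apply: eq_bigl => f; apply/esym/PkP => i i' li.
  by have := ltn_ord i; lia.
rewrite {}IH 1?ltnW //; set m := (l - k.+1)%N.
have -> : (l - k = m.+1)%N by rewrite /m; lia.
have ml : (m < l)%N by rewrite /m; lia.
case: (ltnP m.+1 l) => ml'; last first.
  apply: eq_bigl => f; apply/PkP/PkP => H i i' mi ii'; apply: H => //.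
    by have := ltn_ord i'; lia.
  by lia.
pose o := Ordinal ml; pose o' := Ordinal ml'.
rewrite (bigID (fun f : {ffun 'I_l -> 'I_K.+1} => f o <= f o')%N) /=.
rewrite strict_sum0 // ?add0r.
  apply: eq_bigl => f; apply/andP/PkP => [[/PkP H foo] i i' mi ii'|H].
    case: (ltngtP m i) mi => // [mi _|mi _]; first exact: H.
    have -> : i = o by apply: val_inj.
    have -> : i' = o' by apply: val_inj; rewrite /= mi.
    by rewrite ltnNge.
  split; last by rewrite -ltnNge H.
  by apply/PkP => i i' mi ii'; apply: H => //; lia.
move=> f s; have ne (i : 'I_l) : (m < i)%N -> (i == o) = false.
  by move=> mi; apply/eqP => /(congr1 val) /=; lia.
apply/PkP/PkP => H i i' mi ii'; have := H i i' mi ii'; rewrite !ffunE !ne //; lia.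
Qed.

End OneVariable.

(** * The determinant as a function of lam *)

#[local] Arguments hsym : simpl never.

Definition convolution (A : comNzRingType) (u w : nat -> A) (d : nat) : A :=
  \sum_(m < d.+1) u m * w (d - m)%N.

Lemma geometric_convr (A : comNzRingType) (x : A) u w w' : geometric x w w' ->
  geometric x (convolution u w) (convolution u w').
Proof.
case=> w0 wS; split=> [|d]; first by rewrite /convolution !big_ord1 subnn w0.
rewrite /convolution ![\sum_(_ < d.+2) _]big_ord_recr /= subnn w0.
rewrite addrAC mulr_sumr -big_split; congr (_ + _); apply: eq_bigr => m _ /=.
have md : (m <= d)%N by rewrite -ltnS.
by rewrite subSn // wS mulrDr mulrCA.
Qed.

Lemma convolutionC (A : comNzRingType) (u w : nat -> A) :
  convolution u w =1 convolution w u.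
Proof.
move=> d; rewrite /convolution (reindex_inj rev_ord_inj) /=.
apply: eq_bigr => m _; rewrite subSS mulrC subKn // -ltnS; exact: ltn_ord.
Qed.

Lemma geometric_ext (A : comNzRingType) (x : A) w1 w1' w2 w2' :
  w1 =1 w2 -> w1' =1 w2' -> geometric x w1 w1' -> geometric x w2 w2'.
Proof. by move=> e e' [w0 wS]; split=> [|d]; rewrite -!e -!e'. Qed.

Lemma geometric_convl (A : comNzRingType) (x : A) u u' w : geometric x u u' ->
  geometric x (convolution u w) (convolution u' w).
Proof.
move=> gu; apply: geometric_ext (geometric_convr w gu); exact: convolutionC.
Qed.

Definition shift (A : comNzRingType) (q : nat) (w : nat -> A) (p : nat) : A :=
  if (q <= p)%N then w (p - q)%N else 0.

Lemma geometric_shift (A : comNzRingType) (x : A) q w w' : geometric x w w' ->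
  geometric x (shift q w) (shift q w').
Proof.
case=> w0 wS; rewrite /shift; split=> [|d].
  by case: q => [|q] //=; rewrite w0.
case: (ltngtP q d.+1) => [qd|qd|qd].
- by rewrite -ltnS qd subSn // wS.
- by have -> : (q <= d)%N = false; [lia | rewrite mulr0 addr0].
- have -> : (q <= d)%N = false by lia.
  by rewrite qd subnn w0 mulr0 addr0.
Qed.

Lemma geometric_hsym (A : comNzRingType) (s : seq A) a :
  geometric a (fun m : nat => hsym s m) (fun m : nat => hsym (rcons s a) m).
Proof. by split=> [|d]; rewrite ?hsym0 ?hsym_rconsS. Qed.

Lemma det_zero_block (A : comNzRingType) l (M : 'M[A]_l) (k : 'I_l) :
  (forall i j : 'I_l, (i <= k)%N -> (k <= j)%N -> M i j = 0) -> \det M = 0.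
Proof.
move=> M0; apply: big1 => /= s _.
have [/existsP[i /andP[ik ki]]|/existsPn H] :=
    boolP [exists i : 'I_l, (i <= k <= s i)%N].
  by rewrite (bigD1 i) //= M0 // mul0r mulr0.
have lt (i : 'I_k.+1) : (s (widen_ord (ltn_ord k) i) < k)%N.
  by have := H (widen_ord (ltn_ord k) i); rewrite /= -ltnS ltn_ord /= -ltnNge.
have /leq_card : injective (fun i => Ordinal (lt i)).
  move=> i j /(congr1 val) /= /val_inj/perm_inj/(congr1 val) /= ij.
  exact: val_inj.
by rewrite !card_ord ltnn.
Qed.

Section Alphabets.
Variables (A : comNzRingType) (t : nat -> A).

Definition alpha (i j m : nat) : A :=
  if (j <= i)%N then hsym [seq t r | r <- index_iota j i] m%:Z
  else Defs.esym [seq - t r | r <- index_iota i j] m.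

Lemma alpha_le i j m : (i <= j)%N ->
  alpha i j m = Defs.esym [seq - t r | r <- index_iota i j] m.
Proof.
rewrite /alpha leq_eqVlt => /predU1P[->|/ltn_geF->//].
rewrite leqnn /index_iota subnn /= hsym_nil.
by case: m => [|m]; rewrite ?esym0 // esym_oversize.
Qed.

Lemma alpha_large i j m : (i <= j)%N -> (j - i < m)%N -> alpha i j m = 0.
Proof.
by move=> ij m_gt; rewrite alpha_le // esym_oversize // size_map size_iota.
Qed.

Lemma alpha0 i j : alpha i j 0 = 1.
Proof. by rewrite /alpha; case: ifP; rewrite ?hsym0 ?esym0. Qed.

Lemma geometric_alpha i j : geometric (t i) (alpha i j) (alpha i.+1 j).
Proof.
split=> [|m]; first by rewrite !alpha0.
case: (leqP j i) => ij.
  rewrite /alpha ij (leqW ij) /index_iota subSn // -addn1 iotaD map_cat /=.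
  by rewrite subnKC // cats1 hsym_rconsS.
rewrite (alpha_le _ (ltnW ij)) !alpha_le // /index_iota.
have -> : (j - i = (j - i.+1).+1)%N by lia.
by rewrite /= esym_consS mulNr subrK.
Qed.

End Alphabets.

Section Partitions.
Variables (l N : nat).
Implicit Types nu : {ffun 'I_l -> 'I_N.+1}.

Definition row_len nu (i : nat) : nat :=
  if insub i is Some i' then nu (i' : 'I_l) else 0%N.

Lemma row_lenE nu (i : 'I_l) : row_len nu i = nu i.
Proof. by rewrite /row_len valK. Qed.

Lemma row_len_end nu i : (l <= i)%N -> row_len nu i = 0%N.
Proof. by move=> li; rewrite /row_len insubF // ltnNge li. Qed.

Lemma row_len_max nu i : (row_len nu i <= N)%N.
Proof. by rewrite /row_len; case: insubP => //= i' _ _; rewrite -ltnS. Qed.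

Definition is_part nu : bool :=
  [forall i : 'I_l, forall i' : 'I_l,
     (i' == i.+1 :> nat) ==> (nu i' <= nu i)%N].

Lemma is_partP nu :
  reflect (forall i j, (i <= j)%N -> (row_len nu j <= row_len nu i)%N)
    (is_part nu).
Proof.
apply: (iffP forallP) => [H|H i]; last first.
  by apply/forallP => i'; apply/implyP => /eqP ii'; rewrite -!row_lenE ii' H.
have S i : (row_len nu i.+1 <= row_len nu i)%N.
  case: (ltnP i.+1 l) => il; last by rewrite row_len_end.
  have /forallP/(_ (Ordinal il)) := H (Ordinal (ltnW il)).
  by rewrite /= eqxx /= -!row_lenE.
move=> i j /subnK <-; elim: (j - i)%N => [|k IH] //.
exact: leq_trans (S _) IH.
Qed.

Definition part_le nu nu' : bool := [forall i, (nu i <= nu' i)%N].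

End Partitions.

Section Determinant.
Variables (A : comNzRingType) (l N : nat) (t : nat -> A).
Variable mu : {ffun 'I_l -> 'I_N.+1}.
Implicit Types nu lam : {ffun 'I_l -> 'I_N.+1}.

(* Offsetting lam_i - i and mu_j - j by l makes all indices natural numbers, with
   0 below the support of every column. *)
Definition entry (X : seq A) (i p : nat) (j : 'I_l) : A :=
  shift (mu j + (l - j))
    (convolution (alpha t i j) (fun m : nat => hsym X m)) p.

Definition jt_det (X : seq A) lam : A :=
  \det (\matrix_(i < l, j < l) entry X i (row_len lam i + (l - i)) j).

Definition strip_weight (x : A) (lam nu : nat -> nat) (i : nat) : A :=
  x ^+ (lam i - maxn (nu i) (lam i.+1)) * t i ^+ (lam i.+1 - nu i).

Lemma jt_det_rcons (X : seq A) x lam : is_part lam ->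
  jt_det (rcons X x) lam = \sum_(nu | is_part nu && part_le nu lam)
    (\prod_(i < l) strip_weight x (row_len lam) (row_len nu) i) * jt_det X nu.
Proof.
move=> /is_partP plam.
pose p i := (row_len lam i + (l - i))%N.
have p_dec i : (i < l)%N -> (p i.+1 < p i)%N.
  by move=> il; rewrite /p; have := plam i i.+1 (leqnSn i); lia.
have p_end : p l = 0%N by rewrite /p row_len_end // subnn.
have p_lt i : (p i < (N + l).+1)%N.
  by rewrite /p; have := row_len_max lam i; lia.
have v0 i j : entry X i 0 j = 0.
  by rewrite /entry /shift; case: ifP => //; have := ltn_ord j; lia.
rewrite /jt_det (@det_expand_strict A l (N + l) x t (entry X) _ p) //; first last.
- by move=> i j; apply/geometric_shift/geometric_convr/geometric_hsym.
- by move=> i j; apply/geometric_shift/geometric_convl/geometric_alpha.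
rewrite (bigID (fun f : {ffun 'I_l -> 'I_(N + l).+1} =>
  [forall i : 'I_l, (l - i <= f i <= p i)%N])) /=.
rewrite [X in _ + X]big1 ?addr0; last first.
  move=> f /andP[/forallP sf /forallPn[i]]; rewrite negb_and -!ltnNge.
  case/orP => fi; last first.
    by rewrite (bigD1 i) //= /row_coef leqNgt fi !mul0r.
  have [o ol fo] : exists2 o : 'I_l, (o.+1 = l)%N & (f o = 0 :> nat)%N.
    have l0 : (l.-1 < l)%N by have := ltn_ord i; lia.
    exists (Ordinal l0); first by rewrite /=; lia.
    suff H k (j : 'I_l) : (j + k.+1 = l)%N -> (f (Ordinal l0) + k <= f j)%N.
      have := H (l - i).-1 i; have := ltn_ord i; lia.
    elim: k j => [|k IH] j jk.
      by rewrite addn0; have -> // : j = Ordinal l0 by apply: val_inj => /=; lia.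
    have jl : (j.+1 < l)%N by lia.
    have /forallP/(_ (Ordinal jl)) := sf j; rewrite eqxx /=.
    have := IH (Ordinal jl); rewrite /=; lia.
  rewrite (expand_det_row _ o) [X in _ * X]big1 ?mulr0 // => j _.
  by rewrite mxE fo v0 mul0r.
pose h nu : {ffun 'I_l -> 'I_(N + l).+1} :=
  [ffun i : 'I_l => inord (nu i + (l - i))].
pose h' (f : {ffun 'I_l -> 'I_(N + l).+1}) : {ffun 'I_l -> 'I_N.+1} :=
  [ffun i : 'I_l => inord (f i - (l - i))].
have hE nu i : h nu i = (nu i + (l - i))%N :> nat.
  by rewrite ffunE inordK //; have := ltn_ord (nu i); lia.
rewrite (reindex_onto h h') /=; last first.
  move=> f /andP[_ /forallP fp]; apply/ffunP => i; apply: val_inj => /=.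
  have := fp i; have := row_len_max lam i; rewrite hE ffunE /p => ? ?.
  by rewrite inordK; lia.
apply: eq_big => [nu|nu /andP[/andP[_ /forallP bnd] _]].
  have -> : h' (h nu) = nu.
    by apply/ffunP => i; apply: val_inj; rewrite /= ffunE hE addnK inordK.
  rewrite eqxx andbT; congr (_ && _).
    apply: eq_forallb => i; apply: eq_forallb => i'.
    case: eqP => //= ii'; rewrite !hE; have := ltn_ord i'; lia.
  apply: eq_forallb => i; rewrite hE /p row_lenE; lia.
rewrite /jt_det; congr (_ * _); last first.
  by congr (\det _); apply/matrixP => i j; rewrite !mxE hE row_lenE.
apply: eq_bigr => i _; rewrite /row_coef (andP (bnd i)).2 hE /strip_weight.
rewrite /p row_lenE (row_lenE nu).
by congr (_ ^+ _ * _ ^+ _); have := ltn_ord i; lia.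
Qed.

Lemma jt_det_nil lam : is_part lam -> is_part mu ->
  jt_det [::] lam = (lam == mu)%:R.
Proof.
move=> /is_partP plam /is_partP pmu.
have entryE i j p : entry [::] i p j =
    if (mu j + (l - j) <= p)%N then alpha t i j (p - (mu j + (l - j))) else 0.
  rewrite /entry /shift; case: ifP => // _.
  rewrite /convolution big_ord_recr /= subnn hsym0 mulr1 big1 ?add0r // => m _.
  rewrite hsym_nil [in X in _ * X%:R]subn_eq0 leqNgt ltn_ord; exact: mulr0.
case: eqVneq => [->|ne].
  rewrite /jt_det -det_tr det_trig.
    apply: big1 => i _; rewrite !mxE entryE row_lenE leqnn subnn.
    exact: alpha0.
  apply/is_trig_mxP => i j ij; rewrite !mxE entryE ifF //.
  have := pmu _ _ (ltnW ij); rewrite !row_lenE; have := ltn_ord j; lia.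
have [k] : exists k : 'I_l, lam k != mu k :> nat.
  apply/existsP; apply: contraNT ne => /existsPn H; apply/eqP/ffunP => k.
  by apply/val_inj/eqP; have := H k; rewrite negbK.
rewrite neq_ltn => /orP[lt|lt].
  rewrite /jt_det -det_tr (det_zero_block (k := k)) // => j i jk ki.
  rewrite !mxE entryE ifF //.
  have := pmu _ _ jk; have := plam _ _ ki; rewrite !row_lenE; have := ltn_ord i.
  have := ltn_ord k; lia.
rewrite /jt_det (det_zero_block (k := k)) // => i j ik kj.
rewrite !mxE entryE; case: ifP => // _.
have := pmu _ _ kj; have := plam _ _ ik; rewrite !row_lenE => *.
by rewrite alpha_large //; have := ltn_ord k; have := ltn_ord j; lia.
Qed.

End Determinant.

(** * Fillings of a rectangle *)

Lemma card_ord_lt N b : (b <= N)%N -> #|[pred j : 'I_N | j < b]%N| = b.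
Proof.
move=> bN; rewrite -sum1_card -(big_ord_widen N (fun=> 1%N) bN).
by rewrite sum_nat_const card_ord muln1.
Qed.

Lemma card_ord_itv N a b : (b <= N)%N ->
  #|[pred j : 'I_N | a <= j < b]%N| = (b - a)%N.
Proof.
move=> bN; case: (leqP b a) => [ba|/ltnW ab].
  rewrite (eqP ba); apply: eq_card0 => j; rewrite !inE; apply/negP; lia.
apply/eqP; rewrite -(eqn_add2l a) subnKC // -{1}(card_ord_lt (leq_trans ab bN)).
rewrite -[X in _ == X](card_ord_lt bN).
rewrite -(cardID [pred j : 'I_N | j < a]%N [pred j : 'I_N | j < b]%N).
apply/eqP; congr (_ + _)%N; apply: eq_card => j; rewrite !inE; lia.
Qed.

Lemma initial_ordE N (p : pred 'I_N) :
    (forall i j : 'I_N, (i <= j)%N -> p j -> p i) ->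
  forall j, p j = (j < #|p|)%N.
Proof.
move=> pd j; have jN := ltnW (ltn_ord j); apply/idP/idP => [pj|]; last first.
  apply: contraTT => npj; rewrite -leqNgt -[X in (_ <= X)%N](card_ord_lt jN).
  apply/subset_leq_card/fintype.subsetP => i pi; rewrite inE ltnNge.
  by apply: contra npj => ji; exact: pd pi.
rewrite -[X in (X <= _)%N](card_ord_lt (ltn_ord j)).
by apply/subset_leq_card/fintype.subsetP => i; rewrite inE => ij; exact: pd pj.
Qed.

Section Fillings.
Variables (l N n : nat).
Implicit Types (U : {ffun 'I_l * 'I_N -> 'I_n.+2}).
Implicit Types nu lam mu : {ffun 'I_l -> 'I_N.+1}.

Definition monotone U : bool := [forall c : 'I_l * 'I_N, forall d : 'I_l * 'I_N,
  [&& c.1 <= d.1 & c.2 <= d.2]%N ==> (U c <= U d)%N].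

Lemma monotoneP U : reflect
  (forall c d : 'I_l * 'I_N, (c.1 <= d.1 -> c.2 <= d.2 -> U c <= U d)%N) (monotone U).
Proof.
apply: (iffP forallP) => [H c d cd1 cd2|H c].
  by have /forallP/(_ d) := H c; rewrite cd1 cd2.
by apply/forallP => d; apply/implyP => /andP[]; exact: H.
Qed.

(* A reverse plane partition of shape lam/mu with entries in 1..k is coded by
   its extension to the whole rectangle, 0 on mu and n.+1 outside lam. *)
Definition level mu (k : nat) lam U : bool :=
  [&& monotone U,
      [forall c : 'I_l * 'I_N, (U c == 0 :> nat)%N == (c.2 < mu c.1)%N],
      [forall c : 'I_l * 'I_N, (U c <= k)%N == (c.2 < lam c.1)%N] &
      [forall c : 'I_l * 'I_N, (U c <= k)%N || (U c == n.+1 :> nat)]].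

Lemma levelP mu k lam U : reflect
  [/\ monotone U,
      forall c : 'I_l * 'I_N, (U c == 0 :> nat)%N = (c.2 < mu c.1)%N,
      forall c : 'I_l * 'I_N, (U c <= k)%N = (c.2 < lam c.1)%N &
      forall c : 'I_l * 'I_N, (k < U c)%N -> U c = n.+1 :> nat]
  (level mu k lam U).
Proof.
apply: (iffP and4P).
  move=> [mU /forallP H0 /forallP Hk /forallP Hn]; split=> // c.
  - exact: (eqP (H0 c)).
  - exact: (eqP (Hk c)).
  - by move: (Hn c); case: leqP => //= _ /eqP.
move=> [mU H0 Hk Hn]; split=> //; apply/forallP => c; rewrite ?H0 ?Hk ?eqxx //.
by rewrite -Hk; case: leqP => //= /Hn ->.
Qed.

Definition sublevel U (k : nat) : {ffun 'I_l -> 'I_N.+1} :=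
  [ffun i => inord #|[pred j : 'I_N | (U (i, j) <= k)%N]|].

Lemma sublevelE U k i :
  sublevel U k i = #|[pred j : 'I_N | (U (i, j) <= k)%N]| :> nat.
Proof. by rewrite ffunE inordK // ltnS (leq_trans (max_card _)) ?card_ord. Qed.

Lemma sublevelP U k (c : 'I_l * 'I_N) : monotone U ->
  (U c <= k)%N = (c.2 < sublevel U k c.1)%N.
Proof.
case: c => i j /monotoneP mU; rewrite sublevelE.
rewrite -(initial_ordE (p := [pred j : 'I_N | (U (i, j) <= k)%N])) //.
by move=> a b ab /=; apply: leq_trans; apply: mU.
Qed.

Lemma sublevel_unique U k nu :
  (forall c : 'I_l * 'I_N, (U c <= k)%N = (c.2 < nu c.1)%N) ->
  sublevel U k = nu.
Proof.
move=> H; apply/ffunP => i; apply: val_inj; rewrite /= sublevelE.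
rewrite (eq_card (B := [pred j : 'I_N | j < nu i]%N)) => [|j]; last by rewrite !inE H.
by rewrite card_ord_lt // -ltnS.
Qed.

Lemma eq_sublevel U U' k k' :
  (forall c : 'I_l * 'I_N, (U c <= k)%N = (U' c <= k')%N) ->
  sublevel U k = sublevel U' k'.
Proof.
move=> H; apply/ffunP => i; apply: val_inj; rewrite /= !sublevelE.
by apply: eq_card => j; rewrite !inE H.
Qed.

Lemma sublevel_part U k : monotone U -> is_part (sublevel U k).
Proof.
move=> /monotoneP mU; apply/forallP => i; apply/forallP => i'.
apply/implyP => /eqP ii'; rewrite !sublevelE.
apply/subset_leq_card/fintype.subsetP => j.
by rewrite !inE; apply: leq_trans; apply: mU => //=; rewrite ii'.
Qed.

Lemma sublevel_le U k k' : (k <= k')%N ->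
  part_le (sublevel U k) (sublevel U k').
Proof.
move=> kk'; apply/forallP => i; rewrite !sublevelE.
apply/subset_leq_card/fintype.subsetP => j.
by rewrite !inE => /leq_trans; apply.
Qed.

Variables (A : comNzRingType) (x t : nat -> A).

Definition chain_weight U k : A :=
  \prod_(m < k) \prod_(i < l)
    strip_weight t (x m) (row_len (sublevel U m.+1)) (row_len (sublevel U m)) i.

Definition filling_sum mu k lam : A :=
  \sum_(U | level mu k lam U) chain_weight U k.

Lemma filling_sum0 mu lam : is_part mu -> filling_sum mu 0 lam = (lam == mu)%:R.
Proof.
move=> /is_partP pmu; rewrite /filling_sum; case: eqVneq => [->|ne]; last first.
  apply: big_pred0 => U; apply/negP => /levelP[_ H0 Hk _].
  case/eqP: ne; rewrite -(sublevel_unique Hk); apply: sublevel_unique => c.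
  by rewrite leqn0 H0.
pose U0 : {ffun 'I_l * 'I_N -> 'I_n.+2} :=
  [ffun c : 'I_l * 'I_N => if (c.2 < mu c.1)%N then ord0 else ord_max].
have U0E (c : 'I_l * 'I_N) :
    U0 c = (if (c.2 < mu c.1)%N then 0%N else n.+1) :> nat.
  by rewrite ffunE; case: ifP.
rewrite (big_pred1 U0) => [|U]; first by rewrite /chain_weight big_ord0.
apply/levelP/eqP => [[_ H0 _ Hn]|->].
  apply/ffunP => c; apply: val_inj; rewrite /= U0E -H0.
  by case: eqP => // /eqP; rewrite -lt0n => /Hn.
split.
- apply/monotoneP => c d cd1 cd2; rewrite !U0E.
  by have := pmu _ _ cd1; rewrite !row_lenE; do 2 case: ifP; lia.
- by move=> c; rewrite U0E; case: ifP.
- by move=> c; rewrite U0E; case: ifP.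
- by move=> c; rewrite U0E; case: ifP.
Qed.

Lemma filling_sumS mu k lam : (k < n)%N -> is_part lam ->
  filling_sum mu k.+1 lam = \sum_(nu | is_part nu && part_le nu lam)
    (\prod_(i < l) strip_weight t (x k) (row_len lam) (row_len nu) i) *
    filling_sum mu k nu.
Proof.
move=> kn /is_partP plam; rewrite /filling_sum.
rewrite (partition_big (sublevel ^~ k)
  (fun nu => is_part nu && part_le nu lam)) /=; last first.
  move=> U /levelP[mU _ Hk _]; rewrite sublevel_part // -(sublevel_unique Hk).
  exact: sublevel_le.
apply: eq_bigr => nu /andP[/is_partP pnu /forallP nulam]; rewrite mulr_sumr.
pose cut U : {ffun 'I_l * 'I_N -> 'I_n.+2} :=
  [ffun c : 'I_l * 'I_N => if (U c <= k)%N then U c else ord_max].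
pose ext U : {ffun 'I_l * 'I_N -> 'I_n.+2} :=
  [ffun c : 'I_l * 'I_N => if (U c <= k)%N then U c
             else if (c.2 < lam c.1)%N then inord k.+1 else ord_max].
have cutE U (c : 'I_l * 'I_N) :
    cut U c = (if (U c <= k)%N then U c : nat else n.+1) :> nat.
  by rewrite ffunE; case: ifP.
have extE U (c : 'I_l * 'I_N) : ext U c = (if (U c <= k)%N then U c : nat
    else if (c.2 < lam c.1)%N then k.+1 else n.+1) :> nat.
  by rewrite ffunE; do 2 case: ifP => // _; rewrite inordK //; lia.
have ext_le U m (c : 'I_l * 'I_N) :
    (m <= k)%N -> (ext U c <= m)%N = (U c <= m)%N.
  move=> mk; rewrite extE; case: ifP => // ?.
  by case: ifP => _; apply/idP/idP; lia.
have ext_sublevel U m : (m <= k)%N -> sublevel (ext U) m = sublevel U m.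
  by move=> mk; apply: eq_sublevel => c; rewrite ext_le.
rewrite (reindex_onto ext cut) /=; last first.
  move=> U /andP[/levelP[_ _ Hk Hn] _]; apply/ffunP => c; apply: val_inj => /=.
  rewrite extE cutE -Hk; case: (leqP (U c) k.+1) => [?|/Hn ?];
  by do ?case: ifP; lia.
apply: eq_big => [U|U /andP[/andP[/levelP[_ _ Hk _] /eqP sh] _]]; last first.
  rewrite /chain_weight big_ord_recr /= mulrC sh (sublevel_unique Hk).
  congr (_ * _); apply: eq_bigr => m _; have := ltn_ord m => mk.
  by rewrite !ext_sublevel // ltnW.
apply/andP/levelP =>
  [[/andP[/levelP[/monotoneP mU H0 Hk Hn] /eqP sh] /eqP e]|
   [/monotoneP mU H0 Hk Hn]].
  have shU c : (ext U c <= k)%N = (c.2 < nu c.1)%N.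
    by rewrite -sh; apply: sublevelP; apply/monotoneP.
  have eE c : U c = (if (ext U c <= k)%N then ext U c : nat else n.+1) :> nat.
    by rewrite -cutE e.
  split.
  - apply/monotoneP => c d cd1 cd2; have := mU _ _ cd1 cd2.
    rewrite (eE c) (eE d); have := ltn_ord (ext U c).
    by do 2 case: ifP; lia.
  - by move=> c; rewrite -H0 eE; case: ifP => //; lia.
  - by move=> c; rewrite -shU ext_le.
  - by move=> c; rewrite [in LHS]eE eE; case: ifP => //; lia.
have ecut : cut (ext U) = U.
  apply/ffunP => c; apply: val_inj; rewrite /= cutE ext_le // extE.
  by case: (leqP (U c) k) => // /Hn.
split; last by rewrite ecut.
apply/andP; split; last first.
  by apply/eqP/sublevel_unique => c; rewrite ext_le // Hk.
apply/levelP; split.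
- apply/monotoneP => c d cd1 cd2; have := mU _ _ cd1 cd2; rewrite !extE.
  have := plam _ _ cd1; rewrite !row_lenE.
  by do ?(case: ifP => ?); lia.
- move=> c; rewrite -H0 extE; case: ifP => // ?.
  by case: ifP => _; apply/eqP/eqP; lia.
- move=> c; rewrite extE; case: (leqP (U c) k) => Uk; last first.
    by case: ifP => //; lia.
  have := nulam c.1; have := Hk c; rewrite Uk => /esym ? ?.
  by apply/idP/idP; lia.
- move=> c; rewrite extE; case: ifP => ?; first by lia.
  by case: ifP => //; lia.
Qed.

Lemma filling_sum_jt_det mu k lam : (k <= n)%N -> is_part mu -> is_part lam ->
  filling_sum mu k lam = jt_det t mu (mkseq x k) lam.
Proof.
move=> kn pmu; elim: k kn lam => [|k IH] kn lam plam.
  by rewrite filling_sum0 // jt_det_nil.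
rewrite filling_sumS // mkseqS jt_det_rcons //.
by apply: eq_bigr => nu /andP[pnu _]; rewrite IH // ltnW.
Qed.

End Fillings.

(** * Reverse plane partitions *)

Lemma card_strip_columns l N (nu lam : {ffun 'I_l -> 'I_N.+1}) :
    is_part nu -> is_part lam ->
  #|[pred j : 'I_N | [exists i, (nu i <= j < lam i)%N]]| =
  (\sum_(i < l) (row_len lam i - maxn (row_len nu i) (row_len lam i.+1)))%N.
Proof.
move=> /is_partP pnu /is_partP plam.
pose Q (i : nat) (j : 'I_N) :=
  (maxn (row_len nu i) (row_len lam i.+1) <= j < row_len lam i)%N.
transitivity (\sum_(i < l) #|[pred j : 'I_N | Q i j]|)%N; last first.
  by apply: eq_bigr => i _; rewrite card_ord_itv // row_len_max.
under eq_bigr do rewrite -sum1_card big_mkcond.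
rewrite -sum1_card big_mkcond exchange_big; apply: eq_bigr => j _ /=.
rewrite inE; under eq_bigr do rewrite inE.
case: ifP => [/existsP[i0 /andP[nui0 i0lam]]|/existsPn H]; last first.
  rewrite big1 // => i _; case: ifP => // Qi; have := H i.
  by move: Qi; rewrite /Q !row_lenE; lia.
pose k := [arg max_(i > i0 | j < lam i) (i : nat)]%N.
have [jk kmax] : (j < lam k)%N /\ forall i : 'I_l, (j < lam i)%N -> (i <= k)%N.
  by rewrite /k; case: arg_maxnP.
have kS : (row_len lam k.+1 <= j)%N.
  case: (ltnP k.+1 l) => kl; last by rewrite row_len_end.
  have := kmax (Ordinal kl); rewrite -row_lenE /= ltnn; case: leqP => // _.
  by move=> /(_ isT).
rewrite (bigD1 k) //= ifT; last first.
  have := pnu _ _ (kmax _ i0lam); rewrite /Q !row_lenE jk => ?; lia.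
rewrite big1 // => i ik; case: ifP => //; rewrite /Q => Qi.
case: (ltngtP i k) => [lt|gt|/val_inj e]; last by rewrite e eqxx in ik.
  by have := plam _ _ lt; rewrite (row_lenE lam k); lia.
by have := plam _ _ gt; lia.
Qed.

Lemma sorted_geq_tnth l (s : l.-tuple nat) (i j : 'I_l) :
  sorted geq s -> (i <= j)%N -> (tnth s j <= tnth s i)%N.
Proof.
move=> srt ij; rewrite !(tnth_nth 0%N).
apply: (@sorted_leq_nth _ geq _ _ 0%N s) => //; rewrite ?inE ?size_tuple //.
- by move=> a b c ab ca; exact: leq_trans ca ab.
- by move=> a; exact: leqnn.
Qed.

Section ExtendedFillings.
Variables (l n : nat) (lam mu : l.-tuple nat).
Hypothesis lam_partition : sorted geq lam.
Hypothesis mu_partition : sorted geq mu.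
Hypothesis mu_sub_lam : forall i : 'I_l, (tnth mu i <= tnth lam i)%N.

Local Notation N := (head 0%N lam).

Lemma tnth_le_head (i : 'I_l) : (tnth lam i <= N)%N.
Proof.
have l0 : (0 < l)%N := leq_ltn_trans (leq0n i) (ltn_ord i).
have := sorted_geq_tnth (i := Ordinal l0) (j := i) lam_partition (leq0n i).
by rewrite [tnth lam (Ordinal _)](tnth_nth 0%N) nth0.
Qed.

Definition tuple_part (s : l.-tuple nat) : {ffun 'I_l -> 'I_N.+1} :=
  [ffun i => inord (tnth s i)].

Lemma lam_partE (i : 'I_l) : tuple_part lam i = tnth lam i :> nat.
Proof. by rewrite ffunE inordK // ltnS tnth_le_head. Qed.

Lemma mu_partE (i : 'I_l) : tuple_part mu i = tnth mu i :> nat.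
Proof.
by rewrite ffunE inordK // ltnS (leq_trans (mu_sub_lam i)) ?tnth_le_head.
Qed.

Lemma lam_is_part : is_part (tuple_part lam).
Proof.
apply/forallP => i; apply/forallP => i'; apply/implyP => /eqP ii'.
by rewrite !lam_partE sorted_geq_tnth // ii'.
Qed.

Lemma mu_is_part : is_part (tuple_part mu).
Proof.
apply/forallP => i; apply/forallP => i'; apply/implyP => /eqP ii'.
by rewrite !mu_partE sorted_geq_tnth // ii'.
Qed.

Local Notation cell := ('I_l * 'I_N)%type.
Local Notation box := (box lam mu).
Implicit Types (T : {ffun box -> 'I_n}) (b : box) (c : cell).

Definition extend T : {ffun cell -> 'I_n.+2} :=
  [ffun c : cell => if insub c is Some b then inord (T b).+1
            else if (c.2 < tnth mu c.1)%N then ord0 else ord_max].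

Lemma extend_box T b : extend T (val b) = (T b).+1 :> nat.
Proof. by rewrite ffunE valK inordK // !ltnS ltnW. Qed.

Lemma extend_out T c : ~~ in_skew mu c ->
  extend T c = (if (c.2 < tnth mu c.1)%N then 0%N else n.+1) :> nat.
Proof. by move=> nc; rewrite ffunE insubN //; case: ifP. Qed.

Lemma extend_inj : injective extend.
Proof.
move=> T T' e; apply/ffunP => b; apply: val_inj.
by apply/eq_add_S; rewrite /= -!extend_box e.
Qed.

Lemma extend_eqS T c (m : 'I_n) :
  (extend T c == m.+1 :> nat) = [exists b : box, (val b == c) && (T b == m)].
Proof.
apply/eqP/existsP => [|[b /andP[/eqP <- /eqP <-]]]; last exact: extend_box.
have [sc|nc] := boolP (in_skew mu c).
  rewrite -[c]/(val (Sub c sc : box)) extend_box => -[e].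
  by exists (Sub c sc); rewrite eqxx; apply/eqP/val_inj.
rewrite extend_out //; case: ifP => // _ [e].
by have := ltn_ord m; rewrite -e ltnn.
Qed.

Lemma extend_level T :
  is_rpp T = level (tuple_part mu) n (tuple_part lam) (extend T).
Proof.
apply/idP/idP => [/andP[/forallP rowT /forallP colT]|/levelP[/monotoneP mT _ _ _]].
  apply/levelP; split.
  - apply/monotoneP => -[i j] [i' j'] /= ii' jj'.
    have lii := sorted_geq_tnth lam_partition ii'.
    have mii := sorted_geq_tnth mu_partition ii'.
    have mi := mu_sub_lam i; have mi' := mu_sub_lam i'.
    have [sc|nc] := boolP (in_skew mu (i, j)); last first.
      rewrite extend_out //; case: ifP => //; move: nc; rewrite /in_skew /=.
      move=> *; rewrite extend_out /in_skew /=; last by lia.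
      by rewrite ifF //; lia.
    have [sd|nd] := boolP (in_skew mu (i', j')); last first.
      rewrite [X in (_ <= X)%N]extend_out // ifF /=; first by rewrite -ltnS.
      by move: sc nd; rewrite /in_skew /=; lia.
    have se : in_skew mu (i', j) by move: sc sd; rewrite /in_skew /=; lia.
    rewrite -[(i, j)]/(val (Sub (i, j) sc : box)).
    rewrite -[(i', j')]/(val (Sub (i', j') sd : box)) !extend_box ltnS.
    apply: (@leq_trans (T (Sub (i', j) se))).
      have /forallP/(_ (Sub (i', j) se)) := colT (Sub (i, j) sc).
      by rewrite /bcol /brow /= eqxx ii'.
    have /forallP/(_ (Sub (i', j') sd)) := rowT (Sub (i', j) se).
    by rewrite /bcol /brow /= eqxx jj'.
  - move=> c; have [sc|nc] := boolP (in_skew mu c).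
      rewrite mu_partE -{1}[c]/(val (Sub c sc : box)) extend_box.
      by have /andP[le _] := sc; rewrite ltnNge le.
    by rewrite extend_out // mu_partE; case: ifP.
  - move=> c; rewrite lam_partE; have [sc|nc] := boolP (in_skew mu c).
      rewrite -{1}[c]/(val (Sub c sc : box)) extend_box ltn_ord.
      by have /andP[_ ->] := sc.
    rewrite extend_out //; have := mu_sub_lam c.1; move: nc; rewrite /in_skew.
    by case: ifP => ? ? ?; apply/idP/idP; lia.
  move=> c; have [sc|nc] := boolP (in_skew mu c).
    by rewrite -{1}[c]/(val (Sub c sc : box)) extend_box ltnNge ltn_ord.
  by rewrite extend_out //; case: ifP.
apply/andP; split; apply/forallP => b; apply/forallP => d.
  apply/implyP => /andP[/eqP e le]; rewrite -ltnS -!extend_box.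
  by apply: mT => //; rewrite [(val b).1]e.
apply/implyP => /andP[/eqP e le]; rewrite -ltnS -!extend_box.
by apply: mT => //; rewrite [(val b).2]e.
Qed.

Lemma extend_surj U : level (tuple_part mu) n (tuple_part lam) U ->
  exists T, extend T = U.
Proof.
move=> /levelP[_ H0 Hn Hbig].
have bnd b : ((U (val b)).-1 < n)%N.
  have := H0 (val b); have := Hn (val b); have := valP b.
  rewrite /in_skew mu_partE lam_partE.
  by move=> /andP[? ->] ?; case: eqP => //; lia.
pose T : {ffun box -> 'I_n} := [ffun b => Ordinal (bnd b)].
exists T; apply/ffunP => c; apply: val_inj => /=.
have := H0 c; have := Hn c; rewrite mu_partE lam_partE.
have [sc|nc] := boolP (in_skew mu c).
  have -> : extend T c = (T (Sub c sc)).+1 :> nat.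
    exact: (extend_box T (Sub c sc)).
  rewrite ffunE /=.
  have /andP[ge ->] := sc; rewrite ltnNge ge => _ /negbT; rewrite -lt0n.
  exact: prednK.
rewrite extend_out //; case: ifP => [_ _ /eqP //|c_mu Hc _].
rewrite Hbig // ltnNge Hc.
by move: nc; rewrite /in_skew; lia.
Qed.

Lemma sum_extend (V : nmodType) (F : {ffun cell -> 'I_n.+2} -> V) :
  \sum_(T | is_rpp T) F (extend T) =
  \sum_(U | level (tuple_part mu) n (tuple_part lam) U) F U.
Proof.
rewrite [RHS](reindex_omap extend (fun U => [pick T | extend T == U]))
  => [|U lU]; last first.
  case: pickP => [T /eqP <- //|H]; have [T eT] := extend_surj lU.
  by have := H T; rewrite eT eqxx.
apply: eq_bigl => T; rewrite extend_level.
case: pickP => [T' /eqP/extend_inj->|/(_ T)].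
  by rewrite eqxx andbT.
by rewrite eqxx.
Qed.

Lemma extend_eq_itv T c m : is_rpp T ->
  (extend T c == m.+1 :> nat) =
  (sublevel (extend T) m c.1 <= c.2 < sublevel (extend T) m.+1 c.1)%N.
Proof.
rewrite extend_level => /levelP[mT _ _ _].
rewrite leqNgt -!sublevelP //; lia.
Qed.

Lemma rpp_colsE T (m : 'I_n) : is_rpp T ->
  rpp_cols T m = (\sum_(i < l) (row_len (sublevel (extend T) m.+1) i -
    maxn (row_len (sublevel (extend T) m) i)
      (row_len (sublevel (extend T) m.+1) i.+1)))%N.
Proof.
move=> rT.
have /levelP[mT _ _ _] : level (tuple_part mu) n (tuple_part lam) (extend T).
  by rewrite -extend_level.
rewrite -card_strip_columns ?sublevel_part //; apply: eq_card => j; rewrite !inE.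
apply/existsP/existsP => [[b /andP[/eqP bj Tb]]|[i ij]].
  exists (brow b); rewrite -bj -(extend_eq_itv _ _ rT) extend_eqS.
  apply/existsP; exists b; rewrite Tb andbT /brow /bcol.
  by case: (val b) => *; exact: eqxx.
move: ij; rewrite -(extend_eq_itv (i, j) _ rT) extend_eqS.
by move=> /existsP[b /andP[/eqP e Tb]]; exists b; rewrite Tb /bcol e eqxx.
Qed.

Lemma rpp_dupsE T (r : 'I_l) : is_rpp T ->
  rpp_dups T r = (\sum_(m < n) (row_len (sublevel (extend T) m.+1) r.+1 -
    row_len (sublevel (extend T) m) r))%N.
Proof.
move=> rT.
have /levelP[mT _ _ _] : level (tuple_part mu) n (tuple_part lam) (extend T).
  by rewrite -extend_level.
rewrite /rpp_dups -sum1_card (partition_big T xpredT) //=.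
apply: eq_bigr => m _; rewrite row_lenE.
rewrite -(card_ord_itv _ (row_len_max (sublevel (extend T) m.+1) r.+1)).
rewrite -sum1_card.
set B := [pred b : box | (b \in [pred c : box | (brow c == r) &&
  [exists d : box, [&& brow d == (brow c).+1 :> nat, bcol d == bcol c
                     & T d == T c]]]) && (T b == m)].
rewrite (eq_bigl (mem B)); last by move=> b; rewrite inE.
rewrite !sum1_card -(card_in_image (f := @bcol l lam mu) (A := B)); last first.
  move=> b b' /andP[/andP[/eqP br _] _] /andP[/andP[/eqP br' _] _] e.
  apply/val_inj; rewrite [LHS]surjective_pairing [RHS]surjective_pairing.
  by rewrite -/(brow b) -/(brow b') br br' -/(bcol b) -/(bcol b') e.
apply: eq_card => j; rewrite [RHS]inE; apply/fintype.imageP/idP.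
  move=> [b /andP[/andP[/eqP br /existsP[d /and3P[dr dc Td]]] Tb] ->].
  have := extend_eqS T (val b) m.
  rewrite (extend_eq_itv _ _ rT) -/(brow b) -/(bcol b) br.
  have -> : [exists b0 : box, (val b0 == val b) && (T b0 == m)].
    by apply/existsP; exists b; rewrite eqxx.
  have := extend_eqS T (val d) m.
  rewrite (extend_eq_itv _ _ rT) -/(brow d) -/(bcol d).
  have -> : [exists b0 : box, (val b0 == val d) && (T b0 == m)].
    by apply/existsP; exists d; rewrite eqxx (eqP Td).
  rewrite (eqP dc) -(row_lenE _ (brow d)) -(row_lenE _ (brow d)) (eqP dr) br.
  by move=> /andP[_ ->] /andP[->].
move=> /andP[ge lt].
have rl : (r.+1 < l)%N.
  by rewrite ltnNge; apply/negP => lr; rewrite row_len_end in lt.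
pose r' := Ordinal rl.
have lt' : (j < sublevel (extend T) m.+1 r')%N by rewrite -row_lenE.
have /is_partP pm := sublevel_part m mT.
have /is_partP pmS := sublevel_part m.+1 mT.
have rr' : (r <= r')%N by rewrite /= leqnSn.
have := extend_eq_itv (r, j) m rT; rewrite /= ge /=.
have -> : (j < sublevel (extend T) m.+1 r)%N.
  by apply: leq_trans lt' _; have := pmS _ _ rr'; rewrite !row_lenE.
rewrite extend_eqS => /existsP[b /andP[/eqP eb Tb]].
have := extend_eq_itv (r', j) m rT; rewrite /= lt' andbT.
have -> : (sublevel (extend T) m r' <= j)%N.
  by apply: leq_trans ge; have := pm _ _ rr'; rewrite !row_lenE.
rewrite extend_eqS => /existsP[d /andP[/eqP ed Td]].
exists b; last by rewrite /bcol eb.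
rewrite !inE /brow eb eqxx Tb andbT; apply/existsP; exists d.
by rewrite /bcol ed eb /= !eqxx (eqP Tb) Td.
Qed.

Lemma chain_weight_extend (A : comNzRingType) (x t : nat -> A) T : is_rpp T ->
  chain_weight x t (extend T) n =
  (\prod_(r < l) t r ^+ rpp_dups T r) * (\prod_(m < n) x m ^+ rpp_cols T m).
Proof.
move=> rT; rewrite /chain_weight.
rewrite (eq_bigr (fun r : 'I_l => \prod_(m < n)
    t r ^+ (row_len (sublevel (extend T) m.+1) r.+1 -
      row_len (sublevel (extend T) m) r))); last first.
  by move=> r _; rewrite rpp_dupsE // prodrXr.
rewrite [X in _ = _ * X](eq_bigr (fun m : 'I_n => \prod_(r < l) x m ^+
    (row_len (sublevel (extend T) m.+1) r -
     maxn (row_len (sublevel (extend T) m) r)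
      (row_len (sublevel (extend T) m.+1) r.+1)))); last first.
  by move=> m _; rewrite rpp_colsE // prodrXr.
rewrite [X in _ = X * _]exchange_big mulrC -big_split; apply: eq_bigr => m _.
exact: big_split.
Qed.

End ExtendedFillings.

Lemma hsym_neg (A : comNzRingType) (s : seq A) (k : int) :
  k < 0 -> hsym s k = 0.
Proof. by case: k. Qed.

Section Indeterminates.
Variables (R : comNzRingType) (n l : nat).

Definition xval (i : nat) : {mpoly R[n + l]} :=
  if insub i is Some i' then xvar R l i' else 0.
Definition tval (i : nat) : {mpoly R[n + l]} :=
  if insub i is Some i' then tvar R n i' else 0.

Lemma xvalE (i : 'I_n) : xval i = xvar R l i.
Proof. by rewrite /xval valK. Qed.

Lemma tvalE (i : 'I_l) : tval i = tvar R n i.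
Proof. by rewrite /tval valK. Qed.

Lemma xvars_mkseq : xvars R n l = mkseq xval n.
Proof.
rewrite /mkseq -val_enum_ord -map_comp; apply: eq_map => i /=.
by rewrite xvalE.
Qed.

Lemma tvars_iota a b : (b <= l)%N -> tvars R n l a b = map tval (index_iota a b).
Proof.
move=> bl; have <- : [seq i <- iota 0 l | (a <= i < b)%N] = index_iota a b.
  apply: (irr_sorted_eq ltn_trans ltnn); rewrite ?iota_ltn_sorted //.
    by apply: sorted_filter (iota_ltn_sorted _ _); exact: ltn_trans.
  by move=> i; rewrite mem_filter mem_index_iota mem_iota; lia.
rewrite -val_enum_ord filter_map -map_comp; apply: eq_map => i /=.
by rewrite tvalE.
Qed.

Lemma jt_alphaE (i j : 'I_l) m : jt_alpha R n i j m = alpha tval i j m.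
Proof.
by rewrite /jt_alpha /alpha !tvars_iota ?(ltnW (ltn_ord _)) // -map_comp.
Qed.

End Indeterminates.

Lemma fsbig_entry (A : comNzRingType) l N (t : nat -> A)
    (mu : {ffun 'I_l -> 'I_N.+1}) (X : seq A) (a i : nat) (j : 'I_l) :
    (i < l)%N ->
  \sum_(m \in [set: nat]%classic)
    alpha t i j m *
    hsym X (a%:Z - (mu j : nat)%:Z - i%:Z + (j : nat)%:Z - m%:Z) =
  entry t mu X i (a + (l - i)) j.
Proof.
move=> il; have jl := ltn_ord j; rewrite /entry /shift; case: ifP => le.
  set d := (a + (l - i) - _)%N; rewrite /convolution.
  have neg (m : nat) : (d < m)%N ->
      a%:Z - (mu j : nat)%:Z - i%:Z + (j : nat)%:Z - m%:Z < 0 by rewrite /d; lia.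
  rewrite -(fsbig_widen (`I_d.+1)%classic) //; last first.
    by move=> m [_ /negP]; rewrite /= -leqNgt => /neg ?; rewrite hsym_neg ?mulr0.
  rewrite -fsbig_ord; apply: eq_bigr => m _; congr (_ * hsym _ _).
  have md : (m <= d)%N by rewrite -ltnS.
  by move: (nat_of_ord m) md => k; rewrite /d; lia.
rewrite fsbig1 // => m _; rewrite hsym_neg ?mulr0 //.
by move: (m : nat) => k; lia.
Qed.

Theorem theorem4p15 (R : comNzRingType) (n l : nat) (lam mu : l.-tuple nat)
    (lam_partition : sorted geq lam) (mu_partition : sorted geq mu)
    (mu_sub_lam : forall i : 'I_l, (tnth mu i <= tnth lam i)%N) :
  skew_dual_groth R n lam mu =
  (\det (\matrix_(i < l, j < l)
     \sum_(m \in [set: nat]%classic)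
       jt_alpha R n i j m *
       hsym (xvars R n l)
         ((tnth lam i)%:Z - (tnth mu j)%:Z - i%:Z + j%:Z - m%:Z)))%R.
Proof.
transitivity (filling_sum n (xval R n l) (tval R n l)
  (tuple_part lam mu) n (tuple_part lam lam)).
  rewrite /filling_sum -sum_extend //; apply: eq_bigr => T rT.
  rewrite chain_weight_extend //.
  by congr (_ * _); apply: eq_bigr => i _; rewrite ?tvalE ?xvalE.
rewrite filling_sum_jt_det ?mu_is_part ?lam_is_part // -xvars_mkseq.
congr (\det _); apply/matrixP => i j; rewrite !mxE -fsbig_entry //.
rewrite row_lenE lam_partE // mu_partE //.
by apply: eq_fsbigr => m _; rewrite jt_alphaE.
Qed.
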